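(* Let $p>3$ be a prime. Then the following polynomial congruences hold in $\mathbb{Z}_{(p)}[t]$: \begin{align*} p\sum_{k=1}^{p-1} \frac{t^{k}}{k\binom{2k}{k}} &\equiv \frac{t\,u_p(2-t)-t^p}{2}+p^2\, t\sum_{k=1}^{p-1} \frac{u_{k}(2-t)}{k^2} \pmod{p^3},\\ p\sum_{k=1}^{p-1} \frac{t^{k}}{k^2\binom{2k}{k}} &\equiv \frac{2-v_p(2-t)-t^p}{2p}-p^2 \sum_{k=1}^{p-1} \frac{v_{k}(2-t)}{k^3} \pmod{p^3},\\ p\sum_{k=1}^{p-1} \frac{t^{k}H_{k-1}(2)}{k\binom{2k}{k}} &\equiv t\sum_{k=1}^{p-1} \frac{u_{k}(2-t)}{k^2} \pmod{p},\\ p\sum_{k=1}^{p-1} \frac{t^{k}H_{k-1}(2)}{k^2\binom{2k}{k}} &\equiv -\sum_{k=1}^{p-1} \frac{v_{k}(2-t)}{k^3} \pmod{p}. \end{align*}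
   Context: The Lucas polynomials $u_n(x),v_n(x)\in\mathbb{Z}[x]$ are defined by $u_0=0$, $u_1=1$, $u_n(x)=x\,u_{n-1}(x)-u_{n-2}(x)$ for $n>1$, and $v_0=2$, $v_1=x$, $v_n(x)=x\,v_{n-1}(x)-v_{n-2}(x)$ for $n>1$. For positive integers $k,s$, $H_k(s)=\sum_{r=1}^k 1/r^s$, and $H_0(s)=0$. $\mathbb{Z}_{(p)}$ denotes the rationals whose denominators are prime to $p$; for polynomials $A,B\in\mathbb{Q}[t]$, $A\equiv B\pmod{p^m}$ means that $A-B\in p^m\mathbb{Z}_{(p)}[t]$. *)

(* Defs.v *)
From mathcomp Require Import all_boot all_order all_algebra.

Set Implicit Arguments.
Unset Strict Implicit.
Unset Printing Implicit Defensive.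

Import Order.TTheory GRing.Theory Num.Theory.
Local Open Scope ring_scope.

Fixpoint lucas_u (n : nat) : {poly int} :=
  if n is n1.+1 then
    if n1 is n2.+1 then 'X * lucas_u n1 - lucas_u n2 else 1
  else 0.

Fixpoint lucas_v (n : nat) : {poly int} :=
  if n is n1.+1 then
    if n1 is n2.+1 then 'X * lucas_v n1 - lucas_v n2 else 'X
  else 2%:P.

(* For P in Z[x], the polynomial P(2 - t) of Q[t]. *)
Definition at_2_sub_t (P : {poly int}) : {poly rat} :=
  map_poly intr P \Po (2%:P - 'X).

Definition harmonic (k s : nat) : rat := \sum_(1 <= r < k.+1) 1 / r%:R ^+ s.

(* The ring Z_(p); denq is the denominator in lowest terms. *)
Definition Zloc (p : nat) : {pred rat} :=
  [pred x | coprime p `|denq x|%N].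

Definition congr_Zloc (p m : nat) (A B : {poly rat}) : Prop :=
  exists2 C : {poly rat}, C \is a polyOver (Zloc p) & A - B = p%:R ^+ m *: C.

(* Main.v *)
Require Import Defs.
From HB Require Import structures.
From mathcomp Require Import all_boot all_order all_algebra.
From mathcomp Require Import cyclic finfield zify ring.

Import GRing.Theory Num.Theory.
Local Open Scope ring_scope.

(** Put q_k = (X - 1^2)(X - 2^2)...(X - k^2).  The coefficients of t^(k+1) in
    t u_n(2-t) and v_n(2-t) are binomials C(n+k, 2k+1) up to sign and a rational
    factor, and C(n+k, 2k+1) = n q_k(n^2) / (2k+1)!.  At n = p, expanding q_k(p^2)
    to first order in p^2 produces H_k(2), which reduces the congruences modulo
    p^3 to those modulo p.  The latter compare p H_k(2) / ((k+1) C(2k+2, k+1))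
    with the sum of q_k(n^2) / n over 0 < n < p, divided by (2k+1)!.  Since
    (2k+1)! may contain one factor p, that sum is needed modulo p^2: pairing n
    with p - n shows that the odd power sums of exponents -1, 3, 5, ..., 2p-3
    vanish modulo p^2, so only the linear coefficient of q_k contributes. *)

(** * The ring Z_(p) and its ideals p^m Z_(p) *)

(** The fraction need not be in lowest terms: by Gauss's lemma its reduced denominator divides d. *)
Lemma Zloc_frac (p : nat) (a : int) (d : nat) :
  (0 < d)%N -> coprime p d -> a%:~R / d%:R \in Zloc p.
Proof.
move=> d_gt0 cpd; rewrite inE; set x := (_ / _).
have dn0 : d%:R != 0 :> rat by rewrite pnatr_eq0 -lt0n.
have E : numq x * d%:Z = a * denq x.
  apply: (@intr_inj rat); rewrite !rmorphM /= numqE mulrAC; congr (_ * _).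
  by rewrite /x -[d%:~R]/(d%:R) divfK.
apply: coprime_dvdr cpd; rewrite -(Gauss_dvdr d (m := `|denq x|%N) (n := `|numq x|%N)).
  by apply/dvdnP; exists `|a|%N; rewrite -[d in LHS]/(`|d%:Z|%N) -!abszM E.
by rewrite coprime_sym coprime_num_den.
Qed.

Lemma Zloc_subring (p : nat) : GRing.subring_closed (Zloc p).
Proof.
have den_gt0 (x : rat) : (0 < `|denq x|)%N by rewrite absz_gt0 denq_eq0.
have denE (x : rat) : (denq x)%:~R = `|denq x|%N%:R :> rat.
  by rewrite -[in LHS]absz_denq.
split=> [|x y xZ yZ|x y xZ yZ].
- by rewrite -[1]divr1 -[1 in X in X / _]/(1%:~R) (Zloc_frac p 1 1) // coprimen1.
- have -> : x - y = (numq x * denq y - numq y * denq x)%:~R / (`|denq x| * `|denq y|)%N%:R.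
    rewrite -{1}[x]divq_num_den -{1}[y]divq_num_den natrM -!denE rmorphB !rmorphM /=.
    by field; rewrite !intr_eq0 !denq_eq0.
  by apply: Zloc_frac; rewrite ?muln_gt0 ?den_gt0 // coprimeMr; apply/andP.
have -> : x * y = (numq x * numq y)%:~R / (`|denq x| * `|denq y|)%N%:R.
  rewrite -{1}[x]divq_num_den -{1}[y]divq_num_den natrM -!denE !rmorphM /=.
  by field; rewrite !intr_eq0 !denq_eq0.
by apply: Zloc_frac; rewrite ?muln_gt0 ?den_gt0 // coprimeMr; apply/andP.
Qed.

HB.instance Definition _ (p : nat) :=
  GRing.isSubringClosed.Build rat (Zloc p) (Zloc_subring p).

Lemma Zloc_invr (p d : nat) : (0 < d)%N -> coprime p d -> d%:R^-1 \in Zloc p.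
Proof. by move=> d0 cpd; rewrite -[_^-1]mul1r -[1]/(1%:~R) Zloc_frac. Qed.

Lemma coprime_lt_prime (p n : nat) : prime p -> (0 < n < p)%N -> coprime p n.
Proof.
move=> p_prime /andP[n0 np]; rewrite prime_coprime //; apply/negP => /dvdn_leq.
by move=> /(_ n0); rewrite leqNgt np.
Qed.

Lemma Zloc_invr_lt (p n : nat) : prime p -> (0 < n < p)%N -> n%:R^-1 \in Zloc p.
Proof.
move=> p_prime np; apply: Zloc_invr; first by case/andP: np.
exact: coprime_lt_prime.
Qed.

(** The ideal p^m Z_(p), so that a congruence becomes membership of a difference. Testing by
    division is faithful only for p > 0, whence that hypothesis in [pZlocP]. *)
Definition pZloc (p m : nat) : {pred rat} :=
  [pred x | x / p%:R ^+ m \in Zloc p].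

Lemma pZloc_zmod (p m : nat) : GRing.zmod_closed (pZloc p m).
Proof.
split=> [|x y xI yI]; rewrite inE ?mul0r ?rpred0 //.
by rewrite mulrBl rpredB.
Qed.

HB.instance Definition _ (p m : nat) :=
  GRing.isZmodClosed.Build rat (pZloc p m) (pZloc_zmod p m).

Lemma pZlocP (p m : nat) (x : rat) : (0 < p)%N ->
  reflect (exists2 c, c \in Zloc p & x = p%:R ^+ m * c) (x \in pZloc p m).
Proof.
move=> p0; have pn0 : p%:R ^+ m != 0 :> rat by rewrite expf_neq0 // pnatr_eq0 -lt0n.
apply: (iffP idP) => [xI|[c cZ ->]]; first by exists (x / p%:R ^+ m) => //; rewrite mulrC divfK.
by rewrite inE mulrC mulKf.
Qed.

Lemma pZlocM (p m n : nat) (x y : rat) : (0 < p)%N ->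
  x \in pZloc p m -> y \in pZloc p n -> x * y \in pZloc p (m + n).
Proof.
move=> p0 /(pZlocP p m x p0)[c cZ ->] /(pZlocP p n y p0)[d dZ ->].
by apply/pZlocP => //; exists (c * d); rewrite ?rpredM // exprD mulrACA.
Qed.

Lemma pZlocMl (p m : nat) (x y : rat) : x \in Zloc p -> y \in pZloc p m ->
  x * y \in pZloc p m.
Proof. by move=> xZ yI; rewrite inE -mulrA rpredM. Qed.

Lemma pZloc_natX (p m : nat) : (0 < p)%N -> p%:R ^+ m \in pZloc p m.
Proof. by move=> p0; apply/pZlocP => //; exists 1; rewrite ?rpred1 ?mulr1. Qed.

Lemma pZloc_dvdn (p n : nat) : (0 < p)%N -> (p %| n)%N -> n%:R \in pZloc p 1.
Proof.
move=> p0 /dvdnP[q ->]; rewrite natrM; apply: pZlocMl; first exact: rpred_nat.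
exact: (pZloc_natX p 1).
Qed.

Lemma congr_ZlocP (p m : nat) (A B : {poly rat}) : (0 < p)%N ->
  (forall k, (A - B)`_k \in pZloc p m) -> congr_Zloc p m A B.
Proof.
move=> p0 AB; exists (p%:R ^- m *: (A - B)).
  by apply/polyOverP => i; rewrite coefZ mulrC; have := AB i; rewrite inE.
by rewrite scalerA divff ?scale1r // expf_neq0 // pnatr_eq0 -lt0n.
Qed.

(** * Power sums and harmonic sums modulo p and p^2 *)

(** Multiplication by a nonzero g permutes F_p and multiplies the power sum by g^m, so the sum
    vanishes once some such g has g^m different from 1. *)
Lemma dvdn_power_sum (p m : nat) : prime p -> ~~ (p.-1 %| m)%N ->
  (p %| \sum_(1 <= n < p) n ^ m)%N.
Proof.
move=> p_prime ndvd.
have p_gt1 := prime_gt1 p_prime.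
have m_gt0 : (0 < m)%N by case: m ndvd; rewrite ?dvdn0.
rewrite (dvdn_pcharf (pchar_Fp p_prime)) natr_sum.
have -> : \sum_(1 <= n < p) (n ^ m)%:R = \sum_(x : 'F_p) x ^+ m.
  (* The added term n = 0 is zero because m > 0. *)
  transitivity (\sum_(0 <= n < p) (n ^ m)%:R : 'F_p).
    by rewrite [RHS]big_ltn ?prime_gt0 // exp0n // add0r.
  rewrite -[X in \sum_(0 <= n < X) _](Fp_cast p_prime) big_mkord; apply: eq_bigr => x _.
  by rewrite natrX natr_Zp.
have [g gn0 gm] : exists2 g : 'F_p, g != 0 & g ^+ m != 1.
  suff : [exists (g : 'F_p | g != 0), g ^+ m != 1] by move=> /exists_inP.
  apply: contraT; rewrite negb_exists_in => /forall_inP all1.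
  (* If g^m = 1 for every nonzero g, then by Fermat X^r - 1 has p - 1 roots, more than its degree
     r. *)
  pose r := (m %% p.-1)%N.
  have r_gt0 : (0 < r)%N by rewrite lt0n.
  have r_lt : (r < p.-1)%N by rewrite ltn_mod; lia.
  have Fermat (x : 'F_p) : x != 0 -> x ^+ p.-1 = 1.
    move=> xn0; apply: (mulfI xn0); rewrite -exprS prednK ?prime_gt0 // mulr1.
    by have := expf_card x; rewrite card_Fp.
  have roots : all (root ('X^r - 1 : {poly 'F_p})) (enum (predC1 (0 : 'F_p))).
    apply/allP => x; rewrite mem_enum inE /= => xn0.
    have := all1 x xn0; rewrite negbK => /eqP.
    rewrite (divn_eq m p.-1) exprD mulnC exprM Fermat // expr1n mul1r -/r => xr.
    by rewrite rootE !hornerE xr subrr.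
  have := max_poly_roots _ roots (enum_uniq _).
  rewrite -size_poly_eq0 size_XnsubC // => /(_ isT).
  by rewrite -cardE cardC1 card_Fp // ltnS leqNgt r_lt.
have sumg : \sum_(x : 'F_p) x ^+ m = g ^+ m * \sum_(x : 'F_p) x ^+ m.
  rewrite big_distrr /= (reindex_inj (mulfI gn0)) /=.
  by apply: eq_bigr => x _; rewrite exprMn.
have /eqP : (g ^+ m - 1) * \sum_(x : 'F_p) x ^+ m = 0.
  by rewrite mulrBl mul1r -sumg subrr.
by rewrite mulf_eq0 subr_eq0 (negPf gm).
Qed.

Lemma pZloc_power_sum (p m : nat) : prime p -> ~~ (p.-1 %| m)%N ->
  \sum_(1 <= n < p) n%:R ^+ m \in pZloc p 1.
Proof.
move=> p_prime ndvd; under eq_bigr do rewrite -natrX.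
by rewrite -natr_sum pZloc_dvdn ?prime_gt0 ?dvdn_power_sum.
Qed.

(** By Fermat 1/n^s is congruent to n^(p-1-s) modulo p, and the exponent p-1-s lies strictly between
    0 and p-1. *)
Lemma pZloc_harmonic (p s : nat) : prime p -> (0 < s < p.-1)%N ->
  \sum_(1 <= n < p) 1 / n%:R ^+ s \in pZloc p 1.
Proof.
move=> p_prime /andP[s0 sp]; have p0 := prime_gt0 p_prime.
have ndvd : ~~ (p.-1 %| p.-1 - s)%N by apply/negP => /dvdn_leq; lia.
rewrite -[X in X \in _](subrK (\sum_(1 <= n < p) n%:R ^+ (p.-1 - s))) rpredD //;
  last exact: pZloc_power_sum.
rewrite -sumrB big_nat; apply: rpred_sum => n /andP[n0 np].
have nn0 : n%:R != 0 :> rat by rewrite pnatr_eq0 -lt0n.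
have -> : 1 / n%:R ^+ s - n%:R ^+ (p.-1 - s)
    = - (n%:R^-1 ^+ s * (n ^ p.-1 - 1)%:R) :> rat.
  rewrite natrB ?expn_gt0 ?n0 // natrX -[in RHS](subnK (ltnW sp)) exprD exprVn.
  by field; rewrite expf_neq0.
rewrite rpredN pZlocMl ?rpredX ?Zloc_invr_lt ?n0 // pZloc_dvdn // -eqn_mod_dvd ?expn_gt0 ?n0 //.
apply/eqP; rewrite -[p.-1](totient_prime p_prime) Euler_exp_totient //.
by rewrite coprime_sym coprime_lt_prime ?n0.
Qed.

(** In the expansion of (n-p)^(m+1), every term beyond first order in p carries p^2. *)
Lemma pZloc_expB (p m n : nat) : (0 < p)%N ->
  (n%:R - p%:R) ^+ m.+1 - n%:R ^+ m.+1 + m.+1%:R * p%:R * n%:R ^+ m \in pZloc p 2.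
Proof.
move=> p0; elim: m => [|m IHm].
  by rewrite !expr1 expr0 [X in X \in _](_ : _ = 0) ?rpred0 //; ring.
rewrite [X in X \in _](_ : _ = (n%:R - p%:R)
    * ((n%:R - p%:R) ^+ m.+1 - n%:R ^+ m.+1 + m.+1%:R * p%:R * n%:R ^+ m)
  + m.+1%:R * n%:R ^+ m * p%:R ^+ 2); last first.
  by rewrite !exprS -[m.+2%:R]natr1; ring.
apply: rpredD; apply: pZlocMl; rewrite ?pZloc_natX ?rpredB ?rpredM ?rpredX ?rpred_nat //.
Qed.

Lemma sum_sub_rev (p : nat) (F : nat -> rat) :
  2 * \sum_(1 <= n < p) F n = \sum_(1 <= n < p) (F n + F (p - n)%N).
Proof.
rewrite big_split /= mulr2n mulrDl mul1r; congr (_ + _).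
by rewrite big_nat_rev; apply: eq_bigr => n _; congr F; lia.
Qed.

(* When p - 1 divides m, the power sum is not small but m + 1 = p is. *)
Lemma pZloc_odd_power_sum (p m : nat) : prime p -> ~~ odd m ->
  (0 < m < p.-1.*2)%N -> 2 * \sum_(1 <= n < p) n%:R ^+ m.+1 \in pZloc p 2.
Proof.
move=> p_prime m_even /andP[m0 mp]; have p0 := prime_gt0 p_prime.
rewrite sum_sub_rev; set E := fun n : nat =>
  (n%:R - p%:R) ^+ m.+1 - n%:R ^+ m.+1 + m.+1%:R * p%:R * n%:R ^+ m : rat.
(* As m+1 is odd, (p-n)^(m+1) = -(n-p)^(m+1), so the zeroth-order terms of each pair cancel. *)
rewrite [X in X \in _](_ : _ = m.+1%:R * p%:R * (\sum_(1 <= n < p) n%:R ^+ m)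
              - \sum_(1 <= n < p) E n); last first.
  rewrite mulr_sumr -sumrB; apply: eq_big_nat => n /andP[_ np].
  rewrite natrB; last exact: ltnW.
  rewrite -[p%:R - _]opprB exprNn -signr_odd /= m_even expr1 /E; ring.
rewrite rpredB ?rpred_sum // => [|n _]; last exact: pZloc_expB.
have [dvd|ndvd] := boolP (p.-1 %| m)%N.
  have -> : m.+1 = p.
    by case/dvdnP: dvd m0 mp => -[|[|c]] -> ? ?; nia.
  rewrite -expr2 mulrC pZlocMl ?pZloc_natX ?rpred_sum // => n _.
  by rewrite rpredX ?rpred_nat.
rewrite -mulrA pZlocMl ?rpred_nat //.
exact: (pZlocM _ 1 1 _ _ p0 (pZloc_natX p 1 p0) (pZloc_power_sum p m p_prime ndvd)).
Qed.

(** Each pair 1/n + 1/(p-n) is -p/n^2 modulo p^2, and the sum of 1/n^2 is divisible by p because 2 <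
    p-1. *)
Lemma Wolstenholme (p : nat) : prime p -> (3 < p)%N ->
  2 * \sum_(1 <= n < p) n%:R^-1 \in pZloc p 2.
Proof.
move=> p_prime p_gt3; have p0 := prime_gt0 p_prime.
have pr1 : p%:R \in pZloc p 1 by exact: (pZloc_natX p 1).
rewrite sum_sub_rev (_ : \sum_(1 <= n < p) _
  = - (p%:R * \sum_(1 <= n < p) 1 / n%:R ^+ 2)
    + \sum_(1 <= n < p) (n%:R^-1 ^+ 2 * (p - n)%N%:R^-1 * p%:R ^+ 2)).
  rewrite rpredD ?rpredN ?(pZlocM p 1 1) ?pZloc_harmonic //; first by lia.
  rewrite big_nat; apply: rpred_sum => n np.
  by rewrite pZlocMl ?pZloc_natX // !rpredM ?Zloc_invr_lt //; lia.
rewrite mulr_sumr -sumrN -big_split; apply: eq_big_nat => n /andP[n0 np] /=.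
rewrite natrB; last exact: ltnW.
have nn0 : n%:R != 0 :> rat by rewrite pnatr_eq0 -lt0n.
have pn0 : p%:R - n%:R != 0 :> rat by rewrite subr_eq0 eqr_nat; lia.
by field; rewrite nn0 pn0.
Qed.

(** * The polynomials q_k and their link with binomials *)

(** This is q_k; x q_k(x^2) is the central factorial (x-k)...(x+k), a product of 2k+1 consecutive
    factors. *)
Definition square_prod (k : nat) : {poly rat} :=
  \prod_(1 <= r < k.+1) ('X - (r%:R ^+ 2)%:P).

Lemma square_prodS (k : nat) :
  square_prod k.+1 = square_prod k * ('X - (k.+1%:R ^+ 2)%:P).
Proof. by rewrite /square_prod big_nat_recr. Qed.

Lemma size_square_prod (k : nat) : size (square_prod k) = k.+1.
Proof. by rewrite /square_prod size_prod_XsubC size_iota subn1. Qed.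

Lemma square_prod_Zloc (p k i : nat) : (square_prod k)`_i \in Zloc p.
Proof.
suff /polyOverP : square_prod k \is a polyOver (Zloc p) by [].
apply: rpred_prod => r _.
by rewrite rpredB ?polyOverX // polyOverC rpredX ?rpred_nat.
Qed.

Lemma harmonicS (k s : nat) : harmonic k.+1 s = harmonic k s + 1 / k.+1%:R ^+ s.
Proof. by rewrite /harmonic big_nat_recr. Qed.

Lemma square_prod_coef0 (k : nat) : (square_prod k)`_0 = (-1) ^+ k * k`!%:R ^+ 2.
Proof.
elim: k => [|k IHk]; first by rewrite /square_prod big_nil coef1 expr0 mul1r expr1n.
rewrite square_prodS mulrBr coefB coefMX coefMC /= IHk factS natrM [(-1) ^+ k.+1]exprS; ring.
Qed.

(** The ratio of the linear to the constant coefficient is minus the sum of the reciprocals of the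
    roots r^2; this is the source of H_k(2). *)
Lemma square_prod_coef1 (k : nat) :
  (square_prod k)`_1 = - ((-1) ^+ k * k`!%:R ^+ 2 * harmonic k 2).
Proof.
elim: k => [|k IHk]; first by rewrite /square_prod /harmonic !big_nil coef1 mulr0 oppr0.
rewrite square_prodS mulrBr coefB coefMX coefMC /= square_prod_coef0 IHk.
rewrite harmonicS factS natrM [(-1) ^+ k.+1]exprS.
by field; rewrite nat1r pnatr_eq0.
Qed.

Lemma square_prod_horner (k : nat) (x : rat) :
  (square_prod k).[x] = (square_prod k)`_0 + (square_prod k)`_1 * x
    + \sum_(i < k) (square_prod k)`_i.+2 * x ^+ i.+2.
Proof.
(* One coefficient beyond the size k+1, a zero, is included so that two terms can be split off even
   when k = 0. *)
rewrite (@horner_coef_wide _ k.+2) ?size_square_prod //.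
by rewrite !big_ord_recl /= expr0 mulr1 expr1 addrA.
Qed.

(** From k to k+1 both sides gain the factor (n^2 - (k+1)^2) / ((2k+2)(2k+3)). *)
Lemma bin_square_prod (n k : nat) :
  'C(n + k, k.*2.+1)%:R = n%:R * (square_prod k).[n%:R ^+ 2] / k.*2.+1`!%:R :> rat.
Proof.
elim: k => [|k IHk].
  by rewrite addn0 bin1 /square_prod big_nil hornerC divr1 mulr1.
apply: (mulIf (_ : k.*2.+3%:R * k.*2.+2%:R != 0)); first by rewrite -natrM pnatr_eq0.
have -> : 'C(n + k.+1, k.+1.*2.+1)%:R * (k.*2.+3%:R * k.*2.+2%:R)
    = (n%:R - k.+1%:R) * (n%:R + k.+1%:R) * 'C(n + k, k.*2.+1)%:R :> rat.
  (* For n <= k both binomials vanish; otherwise n - (k+1) is a genuine subtraction of naturals. *)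
  have [nk|kn] := leqP n k.
    rewrite !bin_small ?mulr0 ?mul0r //; lia.
  rewrite -natrB // -natrD -!natrM; congr (_%:R).
  rewrite addnS doubleS.
  have := mul_bin_diag (n + k).+1 k.*2.+2; rewrite /= => E1.
  have := mul_bin_left (n + k) k.*2.+1 => E2.
  have E3 : (n + k - k.*2.+1 = n - k.+1)%N by lia.
  rewrite E3 in E2; nia.
rewrite IHk square_prodS hornerM hornerXsubC doubleS.
rewrite [k.*2.+3`!]factS [k.*2.+2`!]factS.
move: k.*2.+1`! (fact_gt0 k.*2.+1) => f f_gt0; rewrite !natrM.
have: k.*2.+2%:R != 0 :> rat by rewrite pnatr_eq0.
have: k.*2.+3%:R != 0 :> rat by rewrite pnatr_eq0.
have f0: f%:R != 0 :> rat by rewrite pnatr_eq0 -lt0n.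
move: (k.*2.+2)%:R (k.*2.+3)%:R => a b b0 a0.
by field; rewrite f0 a0 b0.
Qed.

(** * The coefficient congruences modulo p and p^3 *)

(** Expanding q_k gives power sums of exponents -1, 1, 3, ..., 2k+1 <= 2p-3. Twice the sum of the n
    is p^2 - p, and the added term cancels its part -p. *)
Lemma pZloc_sum_square_prod (p k : nat) : prime p -> (3 < p)%N -> (k.+1 < p)%N ->
  2 * (\sum_(1 <= n < p) (square_prod k).[n%:R ^+ 2] / n%:R) + p%:R * (square_prod k)`_1
    \in pZloc p 2.
Proof.
move=> p_prime p_gt3 kp; have p0 := prime_gt0 p_prime.
set q := square_prod k.
have -> : \sum_(1 <= n < p) q.[n%:R ^+ 2] / n%:R
  = q`_0 * (\sum_(1 <= n < p) n%:R^-1) + q`_1 * (\sum_(1 <= n < p) n%:R)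
    + \sum_(i < k) q`_i.+2 * \sum_(1 <= n < p) n%:R ^+ i.+1.*2.+1.
  under [X in _ + X]eq_bigr do rewrite mulr_sumr.
  rewrite exchange_big !mulr_sumr -!big_split; apply: eq_big_nat => n /andP[n0 np] /=.
  have nn0 : n%:R != 0 :> rat by rewrite pnatr_eq0 -lt0n.
  rewrite square_prod_horner !mulrDl; congr (_ + _ + _); first by field.
  rewrite mulr_suml; apply: eq_bigr => i _; rewrite -mulrA; congr (_ * _).
  by rewrite -exprM mul2n doubleS exprS mulrAC divff // mul1r.
have -> : \sum_(1 <= n < p) n%:R = p%:R * (p%:R - 1) / 2 :> rat.
  case: (p) => [|m]; first by rewrite big_nil !mul0r.
  elim: m => [|m IHm]; first by rewrite big_nil; ring.
  by rewrite big_nat_recr // IHm /= -[m.+2%:R]natr1; field.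
rewrite [X in X \in _](_ : _ = q`_0 * (2 * \sum_(1 <= n < p) n%:R^-1) + q`_1 * p%:R ^+ 2
   + \sum_(i < k) q`_i.+2 * (2 * \sum_(1 <= n < p) n%:R ^+ i.+1.*2.+1)).
  apply: rpredD; first apply: rpredD.
  - by apply: pZlocMl; rewrite ?square_prod_Zloc ?Wolstenholme.
  - by apply: pZlocMl; rewrite ?square_prod_Zloc ?pZloc_natX.
  apply: rpred_sum => i _; apply: pZlocMl; first exact: square_prod_Zloc.
  apply: pZloc_odd_power_sum; rewrite ?odd_double //; have := ltn_ord i; lia.
under [X in _ = _ + X]eq_bigr do rewrite mulrCA.
rewrite -mulr_sumr.
by field.
Qed.

(** For m < 2p the only possible multiple of p among the factors of m! is p itself. *)
Lemma Zloc_natr_fact (p m : nat) : prime p -> (m < p.*2)%N -> p%:R / m`!%:R \in Zloc p.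
Proof.
move=> p_prime; have p0 := prime_gt0 p_prime.
have pn0 : p%:R != 0 :> rat by rewrite pnatr_eq0 -lt0n.
have small j : (j < p)%N -> j`!%:R^-1 \in Zloc p.
  elim: j => [|j IHj] jp; first by rewrite invr1 rpred1.
  by rewrite factS natrM invfM rpredM ?IHj ?Zloc_invr_lt //; lia.
elim: m => [|m IHm] mp; first by rewrite divr1 rpred_nat.
have [mp1|pm] := ltnP m.+1 p; first by rewrite rpredM ?rpred_nat ?small.
rewrite factS natrM invfM; have [mE|mp1] := eqVneq m.+1 p.
  by rewrite mE mulrA divff // mul1r small; lia.
rewrite mulrCA rpredM ?IHm //; last by lia.
apply: Zloc_invr => //; rewrite -(@coprime_modr p).
rewrite -[m.+1](subnK pm) modnDr modn_small; last by lia.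
by apply: coprime_lt_prime => //; lia.
Qed.

(** Puts the central binomial over the same (2k+1)! as [bin_square_prod], with the k!^2 of the low
    coefficients of q_k. *)
Lemma central_bin_fact (k : nat) :
  k.+1%:R * 'C(2 * k.+1, k.+1)%:R = 2 * k.*2.+1`!%:R / k`!%:R ^+ 2 :> rat.
Proof.
have f0 : k`!%:R != 0 :> rat by rewrite pnatr_eq0 -lt0n fact_gt0.
have k0 : k.+1%:R != 0 :> rat by rewrite pnatr_eq0.
apply: (mulIf (_ : k`!%:R ^+ 2 * k.+1%:R != 0)); first by rewrite mulf_neq0 ?expf_neq0.
have := @bin_fact (2 * k.+1) k.+1 ltac:(lia).
rewrite (_ : 2 * k.+1 - k.+1 = k.+1)%N; last by lia.
rewrite {2}mul2n doubleS factS [k.*2.+2`!]factS.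
have -> : k.*2.+2 = (2 * k.+1)%N by lia.
move: k.*2.+1`! => f /(congr1 (fun n => n%:R : rat)); rewrite !natrM => E.
transitivity (2 * k.+1%:R * f%:R : rat); first by rewrite -E; ring.
by field.
Qed.

Lemma pZloc_divr (p m : nat) (x : rat) : x \in pZloc p m.+1 -> x / p%:R \in pZloc p m.
Proof. by rewrite !inE -mulrA -invfM -exprS. Qed.

(** Beyond first order, the powers of p^2 are multiples of p^4. *)
Lemma pZloc_square_prod (p k : nat) : (0 < p)%N ->
  (square_prod k).[p%:R ^+ 2] - (square_prod k)`_0 - (square_prod k)`_1 * p%:R ^+ 2
    \in pZloc p 4.
Proof.
move=> p0; rewrite square_prod_horner.
rewrite [X in X \in _](_ : _ = \sum_(i < k) (square_prod k)`_i.+2 * p%:R ^+ (2 * i) * p%:R ^+ 4).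
  apply: rpred_sum => i _; apply: pZlocMl; last exact: pZloc_natX.
  by rewrite rpredM ?square_prod_Zloc ?rpredX ?rpred_nat.
have cancel (a b c : rat) : a + b + c - a - b = c by ring.
rewrite cancel.
apply: eq_bigr => i _; rewrite -mulrA -exprD -exprM; congr (_ * _ ^+ _); lia.
Qed.

(** The third congruence at the coefficient of t^(k+1). *)
Lemma central_coef_harmonic (p k : nat) : prime p -> (3 < p)%N -> (k.+1 < p)%N ->
  p%:R * (harmonic k 2 / (k.+1%:R * 'C(2 * k.+1, k.+1)%:R))
    - \sum_(1 <= n < p) 1 / n%:R ^+ 2 * ((-1) ^+ k * 'C(n + k, k.*2.+1)%:R) \in pZloc p 1.
Proof.
move=> p_prime p_gt3 kp; have p0 := prime_gt0 p_prime.
have := pZloc_sum_square_prod p k p_prime p_gt3 kp.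
have fZ : p%:R / k.*2.+1`!%:R \in Zloc p by apply: Zloc_natr_fact => //; lia.
have f0 : k.*2.+1`!%:R != 0 :> rat by rewrite pnatr_eq0 -lt0n fact_gt0.
have -> : \sum_(1 <= n < p) 1 / n%:R ^+ 2 * ((-1) ^+ k * 'C(n + k, k.*2.+1)%:R)
  = (-1) ^+ k / k.*2.+1`!%:R * \sum_(1 <= n < p) (square_prod k).[n%:R ^+ 2] / n%:R.
  rewrite mulr_sumr; apply: eq_big_nat => n /andP[n0 _]; rewrite bin_square_prod.
  have nn0 : n%:R != 0 :> rat by rewrite pnatr_eq0 -lt0n.
  by move: (k.*2.+1`!%:R) f0 => f f0; field; rewrite f0 nn0.
move: (\sum_(_ <= _ < _) _) => T; rewrite square_prod_coef1 central_bin_fact => TI.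
have ss : (-1) ^+ k * (-1) ^+ k = 1 :> rat by rewrite -expr2 sqrr_sign.
have pn0 : p%:R != 0 :> rat by rewrite pnatr_eq0 -lt0n.
have kf0 : k`!%:R != 0 :> rat by rewrite pnatr_eq0 -lt0n fact_gt0.
(* The possible factor p of (2k+1)! costs one power: the sum is known modulo p^2, the quotient
   modulo p. *)
rewrite [X in X \in _](_ : _ = - (-1) ^+ k * (p%:R / k.*2.+1`!%:R) * 2^-1
   * ((2 * T + p%:R * - ((-1) ^+ k * k`!%:R ^+ 2 * harmonic k 2)) / p%:R)).
  apply: pZlocMl; last exact: pZloc_divr.
  have hZ : 2^-1 \in Zloc p by apply: (Zloc_invr_lt p 2) => //; lia.
  apply: rpredM => //; apply: rpredM => //.
  by rewrite rpredN rpredX ?rpredN1.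
move: (k.*2.+1`!%:R) f0 ((-1) ^+ k) ss {fZ TI} (harmonic k 2) => f f0 s ss H.
apply/eqP; rewrite -subr_eq0; apply/eqP.
(* The two sides agree only through s^2 = 1 for the sign s, so their difference is exhibited as a
   multiple of 1 - s^2. *)
transitivity ((1 - s * s) * (p%:R * H / (2 * f) * k`!%:R ^+ 2)); last first.
  by rewrite ss subrr mul0r.
by field; rewrite f0 pn0 kf0.
Qed.

(** The first congruence at t^(k+1): p^2 times the congruence modulo p is added to the expansion of
    q_k(p^2), and the two terms in H_k(2) cancel. *)
Lemma central_coef (p k : nat) : prime p -> (3 < p)%N -> (k.+1 < p)%N ->
  p%:R * (1 / (k.+1%:R * 'C(2 * k.+1, k.+1)%:R))
    - (1 / 2 * ((-1) ^+ k * 'C(p + k, k.*2.+1)%:R)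
       + p%:R ^+ 2 *
         \sum_(1 <= n < p) 1 / n%:R ^+ 2 * ((-1) ^+ k * 'C(n + k, k.*2.+1)%:R))
    \in pZloc p 3.
Proof.
move=> p_prime p_gt3 kp; have p0 := prime_gt0 p_prime.
have := central_coef_harmonic p k p_prime p_gt3 kp.
move: (\sum_(_ <= _ < _) _) => T; rewrite central_bin_fact => TI.
have fZ : p%:R / k.*2.+1`!%:R \in Zloc p by apply: Zloc_natr_fact => //; lia.
have f0 : k.*2.+1`!%:R != 0 :> rat by rewrite pnatr_eq0 -lt0n fact_gt0.
have := pZloc_square_prod p k p0.
rewrite bin_square_prod square_prod_coef0 square_prod_coef1; set Q := _.[_] => QI.
have ss : (-1) ^+ k * (-1) ^+ k = 1 :> rat by rewrite -expr2 sqrr_sign.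
have pn0 : p%:R != 0 :> rat by rewrite pnatr_eq0 -lt0n.
have kf0 : k`!%:R != 0 :> rat by rewrite pnatr_eq0 -lt0n fact_gt0.
have {}TI := pZlocM _ _ _ _ _ p0 (pZloc_natX p 2 p0) TI.
(* The factors p and 1/p cancel; they only lower the exponent 4 to the 3 needed. *)
have {}QI : - (-1) ^+ k * 2^-1 * (p%:R / k.*2.+1`!%:R) * p%:R *
   ((Q - (-1) ^+ k * k`!%:R ^+ 2 - - ((-1) ^+ k * k`!%:R ^+ 2 * harmonic k 2) * p%:R ^+ 2) / p%:R)
   \in pZloc p 3.
  apply: pZlocMl; last exact: pZloc_divr.
  have hZ : 2^-1 \in Zloc p by apply: (Zloc_invr_lt p 2) => //; lia.
  apply: rpredM; last exact: rpred_nat.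
  apply: rpredM => //; apply: rpredM => //.
  by rewrite rpredN rpredX ?rpredN1.
move: (rpredD TI QI); set L := (X in X \in _ -> _).
set M := (X in _ -> X \in _); suff -> : M = L by [].
rewrite {}/L {}/M.
move: (k.*2.+1`!%:R) f0 ((-1) ^+ k) ss {TI QI fZ} (harmonic k 2) => f f0 s ss H.
apply/eqP; rewrite -subr_eq0; apply/eqP.
transitivity ((1 - s * s) * (p%:R / (2 * f) * k`!%:R ^+ 2 * (1 - p%:R ^+ 2 * H))); last first.
  by rewrite ss subrr mul0r.
by field; rewrite f0 pn0 kf0.
Qed.

(** * Coefficients of the Lucas polynomials at 2 - t *)

Lemma at_2_sub_tB (P Q : {poly int}) :
  at_2_sub_t (P - Q) = at_2_sub_t P - at_2_sub_t Q.
Proof. by rewrite /at_2_sub_t rmorphB comp_polyB. Qed.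

Lemma at_2_sub_t_mulX (P : {poly int}) :
  at_2_sub_t ('X * P) = 2 * at_2_sub_t P - 'X * at_2_sub_t P.
Proof.
by rewrite /at_2_sub_t rmorphM /= map_polyX comp_polyM comp_polyX mulrBl rmorph_nat.
Qed.

(** The recurrence at 2 - t is the second-difference rule C(N+2,j+2) - 2C(N+1,j+2) + C(N,j+2) =
    C(N,j). Two consecutive indices are carried through the induction. *)
Lemma lucas_u_coef (n k : nat) :
  (at_2_sub_t (lucas_u n))`_k = (-1) ^+ k * 'C(n + k, k.*2.+1)%:R.
Proof.
move: n k; suff H n : (forall k, (at_2_sub_t (lucas_u n))`_k
      = (-1) ^+ k * 'C(n + k, k.*2.+1)%:R) /\
    (forall k, (at_2_sub_t (lucas_u n.+1))`_k
      = (-1) ^+ k * 'C(n.+1 + k, k.*2.+1)%:R) by move=> n k; case: (H n).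
elim: n => [|n [IH0 IH1]].
  split=> k; rewrite /at_2_sub_t /= ?rmorph0 ?rmorph1 ?comp_poly0 ?comp_polyC.
    by rewrite coef0 bin_small ?mulr0 //; lia.
  rewrite coefC; case: k => [|k]; first by rewrite mul1r.
  by rewrite bin_small ?mulr0 //; lia.
split=> // k; rewrite -[lucas_u n.+2]/('X * lucas_u n.+1 - lucas_u n).
rewrite at_2_sub_tB at_2_sub_t_mulX !coefB coefXM mulr_natl coefMn IH0 IH1.
case: k => [|k] /=.
  by rewrite !addn0 !bin1 -!natr1; ring.
rewrite IH1 !addnS !addSn doubleS exprS -mulr_natl.
by rewrite !binS !natrD; ring.
Qed.

(** Both sides satisfy the same recurrence; this transfers the coefficients of u to v. *)
Lemma lucas_vE (n : nat) : lucas_v n.+1 = lucas_u n.+2 - lucas_u n.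
Proof.
suff H : lucas_v n.+1 = lucas_u n.+2 - lucas_u n /\
    lucas_v n.+2 = lucas_u n.+3 - lucas_u n.+1 by case: H.
elim: n => [|n [IH0 IH1]].
  have two : 2%:P = 1 + 1 :> {poly int} by rewrite -polyCD.
  by rewrite /= mulr1 !subr0 two opprD addrA.
split=> //; rewrite -[lucas_v n.+3]/('X * lucas_v n.+2 - lucas_v n.+1) IH0 IH1.
rewrite -[lucas_u n.+4]/('X * lucas_u n.+3 - lucas_u n.+2).
rewrite -[lucas_u n.+2]/('X * lucas_u n.+1 - lucas_u n).
by ring.
Qed.

Lemma lucas_v_coef0 (n : nat) : (0 < n)%N -> (at_2_sub_t (lucas_v n))`_0 = 2.
Proof.
case: n => // n _; rewrite lucas_vE at_2_sub_tB coefB !lucas_u_coef !addn0 !bin1.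
by rewrite -!natr1; ring.
Qed.

(** The factor n/(k+1) turns the weights 1/n^3 into 1/n^2, so the congruences for v follow from
    those for u on division by k+1. *)
Lemma lucas_v_coefS (n k : nat) : (0 < n)%N ->
  (at_2_sub_t (lucas_v n))`_k.+1
    = - (n%:R / k.+1%:R * ((-1) ^+ k * 'C(n + k, k.*2.+1)%:R)).
Proof.
case: n => // n _; rewrite lucas_vE at_2_sub_tB coefB !lucas_u_coef.
have k0 : k.+1%:R != 0 :> rat by rewrite pnatr_eq0.
apply: (mulfI k0).
have E : (k.+1 * 'C(n.+2 + k.+1, k.+1.*2.+1) =
    n.+1 * 'C(n.+1 + k, k.*2.+1) + k.+1 * 'C(n + k.+1, k.+1.*2.+1))%N.
  rewrite !addnS !addSn doubleS 2!binS [X in (_ + X)%N]binS.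
  have := mul_bin_left (n + k).+1 k.*2.+1.
  have [kn|nk] := leqP k n.
    have -> : ((n + k).+1 - k.*2.+1 = n - k)%N by lia.
    nia.
  rewrite !bin_small //; lia.
move/(congr1 (fun n => n%:R : rat)): E; rewrite natrD !natrM => E.
rewrite exprS mulrBr mulrCA E; by field; rewrite nat1r.
Qed.

(** * Coefficients of both sides and the four congruences *)

Lemma coef_sum_scaleXn (p k : nat) (a : nat -> rat) :
  (\sum_(1 <= j < p) a j *: 'X^j)`_k = if (0 < k < p)%N then a k else 0.
Proof.
rewrite coef_sum; under eq_bigr do rewrite coefZ coefXn.
transitivity (\sum_(1 <= j < p | j == k) a j); last by rewrite big_nat1_eq.
by rewrite [RHS]big_mkcond; apply: eq_bigr => j _; rewrite eq_sym; case: eqP; rewrite ?mulr1 ?mulr0.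
Qed.

Lemma bin_tail_sum (p k : nat) (c : nat -> rat) : (p <= k.+1)%N ->
  \sum_(1 <= n < p) c n * ((-1) ^+ k * 'C(n + k, k.*2.+1)%:R) = 0.
Proof.
move=> pk; rewrite big_nat big1 // => n /andP[_ np].
by rewrite bin_small ?mulr0 //; lia.
Qed.

(** In degree p and above only t^p survives, as C(2p-1,2p-1) = 1 with an even sign exponent; the t^p
    subtracted in the theorem cancels it. *)
Lemma bin_tail (p k : nat) : odd p -> (p <= k.+1)%N ->
  (-1) ^+ k * 'C(p + k, k.*2.+1)%:R = (k.+1 == p)%:R :> rat.
Proof.
move=> p_odd; rewrite leq_eqVlt => /orP[/eqP pE|pk].
  rewrite pE eqxx -signr_odd (_ : k.+1 + k = k.*2.+1)%N; last by lia.
  by rewrite binn -[odd k]negbK; move: p_odd; rewrite pE /= => ->; rewrite mul1r.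
by rewrite bin_small ?mulr0 ?gtn_eqF //; lia.
Qed.

Lemma coef0_lucas_v_sum (p : nat) :
  (\sum_(1 <= n < p) (1 / n%:R ^+ 3) *: at_2_sub_t (lucas_v n))`_0
    = 2 * \sum_(1 <= n < p) 1 / n%:R ^+ 3.
Proof.
rewrite coef_sum mulr_sumr; apply: eq_big_nat => n /andP[n0 _].
by rewrite coefZ lucas_v_coef0 // mulrC.
Qed.

Lemma coefS_lucas_v_sum (p k : nat) :
  (\sum_(1 <= n < p) (1 / n%:R ^+ 3) *: at_2_sub_t (lucas_v n))`_k.+1
    = - (1 / k.+1%:R * \sum_(1 <= n < p)
           1 / n%:R ^+ 2 * ((-1) ^+ k * 'C(n + k, k.*2.+1)%:R)).
Proof.
rewrite coef_sum mulr_sumr -sumrN; apply: eq_big_nat => n /andP[n0 _].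
rewrite coefZ lucas_v_coefS //; move: ((-1) ^+ k * _) => b.
have nn0 : n%:R != 0 :> rat by rewrite pnatr_eq0 -lt0n.
by field; rewrite nat1r nn0 pnatr_eq0.
Qed.

Lemma coefS_lucas_u_sum (p k : nat) :
  ('X * \sum_(1 <= n < p) (1 / n%:R ^+ 2) *: at_2_sub_t (lucas_u n))`_k.+1
    = \sum_(1 <= n < p) 1 / n%:R ^+ 2 * ((-1) ^+ k * 'C(n + k, k.*2.+1)%:R).
Proof.
rewrite coefXM coef_sum; apply: eq_bigr => n _.
by rewrite coefZ lucas_u_coef.
Qed.

Theorem theorem6p1 (p : nat) (p_prime : prime p) (p_gt3 : (3 < p)%N) :
  [/\ congr_Zloc p 3
        (p%:R *: \sum_(1 <= k < p) (1 / (k%:R * 'C(2 * k, k)%:R)) *: 'X^k)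
        ((1 / 2) *: ('X * at_2_sub_t (lucas_u p) - 'X^p)
         + p%:R ^+ 2 *:
           ('X * \sum_(1 <= k < p) (1 / k%:R ^+ 2) *: at_2_sub_t (lucas_u k))),
      congr_Zloc p 3
        (p%:R *: \sum_(1 <= k < p) (1 / (k%:R ^+ 2 * 'C(2 * k, k)%:R)) *: 'X^k)
        ((1 / (2 * p%:R)) *: (2%:P - at_2_sub_t (lucas_v p) - 'X^p)
         - p%:R ^+ 2 *:
           \sum_(1 <= k < p) (1 / k%:R ^+ 3) *: at_2_sub_t (lucas_v k)),
      congr_Zloc p 1
        (p%:R *: \sum_(1 <= k < p)
                   (harmonic k.-1 2 / (k%:R * 'C(2 * k, k)%:R)) *: 'X^k)
        ('X * \sum_(1 <= k < p) (1 / k%:R ^+ 2) *: at_2_sub_t (lucas_u k))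
    & congr_Zloc p 1
        (p%:R *: \sum_(1 <= k < p)
                   (harmonic k.-1 2 / (k%:R ^+ 2 * 'C(2 * k, k)%:R)) *: 'X^k)
        (- \sum_(1 <= k < p) (1 / k%:R ^+ 3) *: at_2_sub_t (lucas_v k))].
Proof.
have p0 := prime_gt0 p_prime.
have p_odd : odd p by case: (even_prime p_prime) => // p2; rewrite p2 in p_gt3.
have pn0 : p%:R != 0 :> rat by rewrite pnatr_eq0 -lt0n.
(* This controls the constant terms of the v-sums; the exponent 3 needs p > 4, and 4 is not
   prime. *)
have H3 : \sum_(1 <= n < p) 1 / n%:R ^+ 3 \in pZloc p 1.
  by apply: pZloc_harmonic => //; case: (p) p_prime p_gt3 => [|[|[|[|[|m]]]]].
have low k : (k.+1 < p)%N -> 1 / k.+1%:R \in Zloc p.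
  by move=> kp; rewrite mul1r Zloc_invr_lt.
split; apply: congr_ZlocP => // -[|k]; rewrite coefB ?coefN coefZ coef_sum_scaleXn /=.
- rewrite coefD !coefZ coefB !coefXM coefXn /= eq_sym gtn_eqF //.
  by rewrite !(mulr0, subrr, addr0) rpred0.
- rewrite coefD !coefZ coefB coefS_lucas_u_sum coefXM lucas_u_coef coefXn /=.
  case: ltnP => kp.
    by rewrite ltn_eqF // subr0 central_coef.
  by rewrite bin_tail // bin_tail_sum // !(mulr0, subrr, addr0) rpred0.
(* In the constant term 2 - v_p(2) vanishes, which leaves p^2 times twice the sum of 1/n^3. *)
- rewrite coefB !coefZ !coefB coefC lucas_v_coef0 // coef0_lucas_v_sum coefXn /=.
  rewrite eq_sym gtn_eqF // !(mulr0, subrr, add0r, sub0r, opprK).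
  apply: (pZlocM p 2 1) => //; first exact: pZloc_natX.
  by apply: pZlocMl => //; apply: rpred_nat.
- rewrite coefB !coefZ !coefB coefC lucas_v_coefS // coefS_lucas_v_sum coefXn /=.
  have k0 : k.+1%:R != 0 :> rat by rewrite pnatr_eq0.
  case: ltnP => kp.
    rewrite ltn_eqF // subr0.
    (* The factor p in the coefficient of v_p cancels the p of 1/(2p); what remains is the first
       congruence divided by the unit k+1. *)
    have := pZlocMl _ _ _ _ (low k kp) (central_coef p k p_prime p_gt3 kp).
    set L := (X in X \in _ -> _); set M := (X in _ -> X \in _); suff -> : M = L by [].
    rewrite /L /M; move: (\sum_(_ <= _ < _) _) ((-1) ^+ k * _) => T b.
    have : 'C(2 * k.+1, k.+1)%:R != 0 :> rat.
      by rewrite pnatr_eq0 -lt0n bin_gt0; lia.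
    move: ('C(_, _))%:R => c c0.
    by field; rewrite nat1r k0 pn0 c0.
  rewrite bin_tail // bin_tail_sum //; case: eqP => [<-|_].
    by rewrite divff // !(mulr0, mulr1, sub0r, opprK, subrr, oppr0) rpred0.
  by rewrite !(mulr0, sub0r, oppr0, subrr) rpred0.
- by rewrite coefXM mulr0 subrr rpred0.
- rewrite coefS_lucas_u_sum; case: ltnP => kp; first exact: central_coef_harmonic.
  by rewrite bin_tail_sum // mulr0 subrr rpred0.
- by rewrite coef0_lucas_v_sum mulr0 sub0r opprK pZlocMl ?rpred_nat.
rewrite coefS_lucas_v_sum opprK; case: ltnP => kp.
  have := pZlocMl _ _ _ _ (low k kp) (central_coef_harmonic p k p_prime p_gt3 kp).
  set L := (X in X \in _ -> _); set M := (X in _ -> X \in _); suff -> : M = L by [].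
  have k0 : k.+1%:R != 0 :> rat by rewrite pnatr_eq0.
  rewrite /L /M; move: (\sum_(_ <= _ < _) _) => T.
  have : 'C(2 * k.+1, k.+1)%:R != 0 :> rat.
    by rewrite pnatr_eq0 -lt0n bin_gt0; lia.
  move: ('C(_, _))%:R => c c0.
  by field; rewrite nat1r k0 c0.
by rewrite bin_tail_sum // !mulr0 subrr rpred0.
Qed.
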